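(* Let $0<\theta<1$ and $Y_\theta:=(\mathcal D(C),\mathcal D(C^2))_{\theta,1}$. Assume that for $0<h\le h_0$ and $t\in[0,T]$ the operators $R_h(t)$ and $P_h(t)$ are well defined in $\mathcal L(\mathcal E_p)$ and that there is a constant $K>0$ with $$\sup_{t\in[0,T]}\|R_h(t)-P_h(t)\|_{\mathcal L(Y_\theta,\mathcal E_p)}\le K h^{1+\theta},\qquad 0<h\le h_0 .$$ (i) Autonomous case. If $D(t)\equiv D$ (so $R_h(t)=R_h$, $P_h(t)=P_h$), assume that for every $T>0$ there exist constants $M_{R,T}$ and $M_{P,T,\theta}$ such that $$\sup_{0<h\le h_0}\sup_{nh\le T}\|R_h^n\|_{\mathcal L(\mathcal E_p)}\le M_{R,T},\qquad \sup_{0<h\le h_0}\sup_{nh\le T}\|P_h^n\|_{\mathcal L(Y_\theta)}\le M_{P,T,\theta}.$$ Then (for every $T>0$) there exists $K_{T,\theta}>0$ such that $\|R_h^n-P_h^n\|_{\mathcal L(Y_\theta,\mathcal E_p)}\le K_{T,\theta}h^\theta$ for all $0<h\le h_0$ and $n$ with $nh\le T$. (ii) Non-autonomous case. For $t_k=kh$ set $R_k:=R_h(t_k)$, $P_k:=P_h(t_k)$, and $\mathcal R_{j:k}:=R_jR_{j-1}\cdots R_k$, $\mathcal P_{j:k}:=P_jP_{j-1}\cdots P_k$ for $j\ge k$ (both equal to $I$ for $j<k$). Assume that there are constants $M_{R,T},M_{P,T,\theta}$ such that for all $0<h\le h_0$ $$\sup_{0\le k\le j,\ jh\le T}\|\mathcal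 R_{j:k}\|_{\mathcal L(\mathcal E_p)}\le M_{R,T},\qquad \sup_{0\le kh\le T}\|\mathcal P_{k-1:0}\|_{\mathcal L(Y_\theta)}\le M_{P,T,\theta}.$$ Then there exists $K_{T,\theta}>0$ such that $\|\mathcal R_{n-1:0}-\mathcal P_{n-1:0}\|_{\mathcal L(Y_\theta,\mathcal E_p)}\le K_{T,\theta}h^\theta$ for all $0<h\le h_0$ and $n$ with $nh\le T$.
   Context: Let $X$ be a Banach space, $\tau<0$, $1<p<\infty$, and $\mathcal E_p:=X\oplus L^p([\tau,0];X)$ with norm $\|(u,\rho)\|_{\mathcal E_p}=\|u\|_X+\|\rho\|_{L^p}$. Let $A$ be a sectorial operator on $X$ (generating a bounded analytic semigroup on $X$) and $A_0=\begin{pmatrix}A&0\\0&0\end{pmatrix}$ with $\mathcal D(A_0)=\mathcal D(A)\oplus L^p([\tau,0];X)$. The transport operator is $C(u,\rho):=(0,\partial_\sigma\rho)$ with domain $\mathcal D(C):=\{(u,\rho)\in X\oplus W^{1,p}([\tau,0];X):\rho(0)=u\}$; $(I-hC)^{-1}\in\mathcal L(\mathcal E_p)$ exists for every $h>0$. $\mathcal D(C)$ carries the graph norm, and $\mathcal D(C^2)=\{x\in\mathcal D(C):Cx\in\mathcal D(C)\}$ carries the norm $\|x\|_{\mathcal E_p}+\|Cx\|_{\mathcal E_p}+\|C^2x\|_{\mathcal E_p}$. $(\cdot,\cdot)_{\theta,1}$ denotes real interpolation. For each $t$, $D(t):\mathcal D(C)\to\mathcal E_p$ is linear. Set, for $0<h\le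 h_0$, $$S_h^{AC}:=(I-hC)^{-1}(I-hA_0)^{-1},\quad H_h(t):=hD(t)S_h^{AC},\quad P_h(t):=(I-H_h(t))^{-1}S_h^{AC},\quad R_h(t):=(I-h(A_0+C+D(t)))^{-1},$$ where $\mathcal D(A_0+C+D(t))=\mathcal D(A_0)\cap\mathcal D(C)$. Standing assumption (operational smallness): there is $q\in(0,1)$ with $\|H_h(t)\|_{\mathcal L(\mathcal E_p)}\le q$ for all $t$ and $0<h\le h_0$, so that $P_h(t)$ is well defined. Writing $\|B\|_{\mathcal L(Y_\theta)}\le M$ means in particular that $B$ maps $Y_\theta$ into itself. *)

(* Defs.v *)
From HB Require Import structures.
From mathcomp Require Import all_boot all_order all_algebra.
From mathcomp Require Import ring_quotient.
From mathcomp Require Import complex.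
From mathcomp Require Import all_classical all_reals all_analysis.
From mathcomp Require Import measurable_realfun.
Set Implicit Arguments.
Unset Strict Implicit.
Unset Printing Implicit Defensive.
Import Order.TTheory GRing.Theory Num.Theory.
Import numFieldNormedType.Exports.
Local Open Scope classical_set_scope.
Local Open Scope complex_scope.
Local Open Scope ring_scope.

(* The norm of a normed module over R[i] takes its values in R[i]; its
   imaginary part is 0. *)
Definition rnorm (R : realType) (X : normedModType R[i]) (x : X) : R :=
  complex.Re `|x|.
Arguments rnorm {R X} x.

Section rnorm_theory.
Context (R : realType) (X : normedModType R[i]).
Implicit Types x y : X.

Lemma rnormE x : (rnorm x)%:C = `|x|.
Proof.
by have /complex_realP[k xk] := normr_real x; rewrite /rnorm xk.
Qed.

Lemma rnorm_ge0 x : 0 <= rnorm x.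
Proof. by rewrite -lecR rnormE normr_ge0. Qed.

Lemma rnorm0 : rnorm (0 : X) = 0.
Proof. by rewrite /rnorm normr0. Qed.

Lemma ler_rnormD x y : rnorm (x + y) <= rnorm x + rnorm y.
Proof. by rewrite -lecR raddfD/= !rnormE ler_normD. Qed.

Lemma ler_dist_rnorm x y : `|rnorm x - rnorm y| <= rnorm (x - y).
Proof.
have rnormB : rnorm (y - x) = rnorm (x - y) by rewrite /rnorm distrC.
have := ler_rnormD (x - y) y; have := ler_rnormD (y - x) x.
rewrite !subrK rnormB => yx xy; rewrite ler_norml lerBlDr xy andbT.
by rewrite lerNl opprB lerBlDr.
Qed.

Lemma rnormZ (a : R[i]) x : rnorm (a *: x) = complex.Re `|a| * rnorm x.
Proof.
have /complex_realP[k ak] := normr_real a.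
by rewrite /rnorm normrZ ak -(rnormE x) -rmorphM.
Qed.

End rnorm_theory.

Section strong_measurability.
Context (R : realType) (X : normedModType R[i]).

Definition simple_fun (s : R -> X) : Prop :=
  finite_set (range s) /\ forall x, measurable (s @^-1` [set x]).

Definition strongly_measurable (f : R -> X) : Prop :=
  exists2 s : nat -> R -> X,
    forall n, simple_fun (s n) & forall t, s n t @[n --> \oo] --> f t.

Definition simple_integral (E : set R) (s : R -> X) : X :=
  \sum_(x \in range s)
    (fine (lebesgue_measure (E `&` s @^-1` [set x])))%:C *: x.

Definition is_bochner_integral (E : set R) (f : R -> X) (v : X) : Prop :=
  strongly_measurable f /\
  exists s : nat -> R -> X, [/\ forall n, simple_fun (s n),
    (\int[lebesgue_measure]_(t in E) (rnorm (f t - s n t))%:E)%E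
      @[n --> \oo] --> (0 : \bar R) &
    simple_integral E (s n) @[n --> \oo] --> v].

(* 0 when f is not Bochner integrable on E *)
Definition bochner_integral (E : set R) (f : R -> X) : X :=
  xget 0 [set v | is_bochner_integral E f v].

Lemma simple_fun_lin (a : R[i]) (s1 s2 : R -> X) :
  simple_fun s1 -> simple_fun s2 -> simple_fun (a *: s1 + s2).
Proof.
move=> [f1 m1] [f2 m2].
have E t : (a *: s1 + s2) t = a *: s1 t + s2 t by [].
split.
  apply: (@sub_finite_set _ _
    ((fun z : X * X => a *: z.1 + z.2) @` (range s1 `*` range s2))).
    by move=> _ [t _ <-]; exists (s1 t, s2 t); split=> //=; exists t.
  by apply: finite_image; exact: finite_setX.
move=> x.
rewrite (_ : _ @^-1` _ = \bigcup_(y in range s1)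
    (s1 @^-1` [set y] `&` s2 @^-1` [set x - a *: y])); last first.
  apply/seteqP; split=> [t /= tx|t [y _ [/= s1t s2t]]].
    by exists (s1 t); [exists t|split=> //=; rewrite -tx E addrAC subrr add0r].
  by rewrite /= E s1t s2t addrC subrK.
apply: fin_bigcup_measurable => // y _; exact: measurableI.
Qed.

Lemma strongly_measurable_lin (a : R[i]) (f g : R -> X) :
  strongly_measurable f -> strongly_measurable g ->
  strongly_measurable (a *: f + g).
Proof.
move=> [s ss sf] [s' ss' sg]; exists (fun n => a *: s n + s' n).
  by move=> n; exact: simple_fun_lin.
by move=> t; apply: cvgD => //; apply: cvgZr.
Qed.

Lemma strongly_measurable0 : strongly_measurable (0 : R -> X).
Proof.
exists (fun=> 0) => [_|t]; last exact: cvg_cst.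
split.
  by apply: (@sub_finite_set _ _ [set 0]) => // _ [t _ <-].
move=> x; have [->|x0] := eqVneq x 0.
  by rewrite (_ : _ @^-1` _ = setT)//; apply/seteqP; split.
rewrite (_ : _ @^-1` _ = set0)//; apply/seteqP; split=> // t /= /esym.
by move/eqP; rewrite (negbTE x0).
Qed.

Lemma measurable_rnorm (f : R -> X) (E : set R) :
  strongly_measurable f -> measurable_fun E (rnorm \o f).
Proof.
move=> [s ss sf]; suff : measurable_fun setT (rnorm \o f).
  exact: measurable_funS.
apply: (measurable_fun_cvg (h := fun n => rnorm \o s n)); last first.
  move=> t _; apply/cvgrPdist_lt => e e0.
  have ec0 : (0 : R[i]) < e%:C by rewrite -[0]/(0%:C) ltcR.
  have /cvgrPdist_lt/(_ _ ec0) := sf t; apply: filterS => n.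
  by rewrite -rnormE ltcR; apply: le_lt_trans; exact: ler_dist_rnorm.
move=> n; have [fs ms] := ss n.
move=> _ Y mY; rewrite setTI.
rewrite (_ : _ @^-1` _ =
    \bigcup_(y in range (s n) `&` rnorm @^-1` Y) (s n @^-1` [set y])).
  apply: fin_bigcup_measurable => [|y _]; last exact: ms.
  exact: finite_setIl.
apply/seteqP; split=> [t /= Yt|t [_ [[u _ <-] Yu]] /= ->//].
by exists (s n t) => //; split=> //; exists t.
Qed.

End strong_measurability.

Section Lp.
Context (R : realType) (X : normedModType R[i]) (tau p : R) (p1 : 1 < p).

Definition pintegral (f : R -> X) : \bar R :=
  (\int[lebesgue_measure]_(t in `[tau, 0%R]) (rnorm (f t) `^ p)%:E)%E.

Definition LpFun_set : set (R -> X) :=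
  [set f | strongly_measurable f /\ (pintegral f < +oo)%E].

Definition LpFun_pred : {pred R -> X} := mem LpFun_set.

Let p0 : 0 <= p. Proof. exact/ltW/(lt_trans ltr01). Qed.

Lemma measurable_rnorm_powR (f : R -> X) (E : set R) :
  strongly_measurable f -> measurable_fun E (fun t => (rnorm (f t) `^ p)%:E).
Proof.
move=> mf; apply/measurable_EFinP.
exact: (measurableT_comp (measurable_powR p) (measurable_rnorm (E := E) mf)).
Qed.

Lemma LpFun_submod_closed : submod_closed LpFun_pred.
Proof.
split.
  rewrite inE; split; first exact: strongly_measurable0.
  rewrite /pintegral (eq_integral (cst 0%E)) ?integral0// => t _.
  by rewrite rnorm0 powR0// gt_eqF// (lt_trans ltr01).
move=> a f g; rewrite !inE => -[mf If] [mg Ig].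
have mfg := strongly_measurable_lin a mf mg.
split=> //.
pose c := complex.Re `|a|.
have c0 : 0 <= c := rnorm_ge0 (a : R[i]^o).
pose F t : \bar R := (((2 * c) `^ p)%:E * (rnorm (f t) `^ p)%:E +
  (2 `^ p)%:E * (rnorm (g t) `^ p)%:E)%E.
apply: (@le_lt_trans _ _ (\int[lebesgue_measure]_(t in `[tau, 0%R]) F t)%E).
  apply: ge0_le_integral => //=.
  - by move=> t _; rewrite lee_fin powR_ge0.
  - exact: measurable_rnorm_powR.
  - by apply: emeasurable_funD; apply: measurable_funeM;
      exact: measurable_rnorm_powR.
  - move=> t _; rewrite /F -!EFinM -EFinD lee_fin.
    have x0 := rnorm_ge0 (f t); have y0 := rnorm_ge0 (g t).
    rewrite -!powRM ?mulr_ge0//.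
    have fgt : rnorm ((a *: f + g) t) <= c * rnorm (f t) + rnorm (g t).
      by apply: le_trans (ler_rnormD _ _) _; rewrite rnormZ.
    have [le|/ltW le] := leP (c * rnorm (f t)) (rnorm (g t)).
      apply: (@le_trans _ _ ((2 * rnorm (g t)) `^ p)); last first.
        by rewrite lerDr powR_ge0.
      apply: ge0_ler_powR; rewrite ?nnegrE ?mulr_ge0 ?rnorm_ge0//.
      by apply: le_trans fgt _; rewrite mulr2n mulrDl mul1r lerD2r.
    apply: (@le_trans _ _ ((2 * c * rnorm (f t)) `^ p)); last first.
      by rewrite lerDl powR_ge0.
    apply: ge0_ler_powR; rewrite ?nnegrE ?mulr_ge0 ?rnorm_ge0//.
    by apply: le_trans fgt _; rewrite -mulrA mulr2n mulrDl mul1r lerD2l.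
rewrite ge0_integralD//=; last 4 first.
- by move=> t _; rewrite -EFinM lee_fin mulr_ge0 ?powR_ge0.
- by apply: measurable_funeM; exact: measurable_rnorm_powR.
- by move=> t _; rewrite -EFinM lee_fin mulr_ge0 ?powR_ge0.
- by apply: measurable_funeM; exact: measurable_rnorm_powR.
rewrite !ge0_integralZl//=; try by [move=> t _; rewrite lee_fin powR_ge0 |
  rewrite lee_fin powR_ge0 | exact: measurable_rnorm_powR].
by rewrite lte_add_pinfty// lte_mul_pinfty ?lee_fin ?powR_ge0.
Qed.

HB.instance Definition _ :=
  GRing.isSubmodClosed.Build _ _ LpFun_pred LpFun_submod_closed.

Record LpFun := MkLpFun { LpFun_val :> R -> X; _ : LpFun_val \in LpFun_pred }.

HB.instance Definition _ := [isSub for LpFun_val].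
HB.instance Definition _ := [Choice of LpFun by <:].
HB.instance Definition _ := [SubChoice_isSubLmodule of LpFun by <:].

Definition null_fun : {pred LpFun} :=
  mem [set f : LpFun |
    {ae (@lebesgue_measure R), forall t, t \in `[tau, 0] -> f t = 0}].

Lemma null_fun_submod_closed : submod_closed null_fun.
Proof.
split; first by rewrite inE; apply: aeW.
have F : Filter (nbhs (almost_everywhere (@lebesgue_measure R))).
  exact: ae_filter_ringOfSetsType.
move=> a f g; rewrite !inE; apply: filterS2 => t f0 g0 tI.
by rewrite -[LHS]/(a *: f t + g t) f0// g0// scaler0 addr0.
Qed.

HB.instance Definition _ :=
  GRing.isSubmodClosed.Build _ _ null_fun null_fun_submod_closed.

(* L^p([tau, 0]; X): functions on R, identified when they agree almost
   everywhere on [tau, 0]. *)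
Definition Lp : Type := Quotient.quot null_fun.

HB.instance Definition _ := GRing.Zmodule.on Lp.
HB.instance Definition _ := Choice.on Lp.

Definition Lp_class (f : LpFun) : Lp := (\pi_(Quotient.quot null_fun) f)%qT.

Definition Lp_rep (rho : Lp) : LpFun := repr (rho : Quotient.quot null_fun).

Definition Lp_fun (rho : Lp) : R -> X := LpFun_val (Lp_rep rho).
Coercion Lp_fun : Lp >-> Funclass.

Lemma Lp_repK : cancel Lp_rep Lp_class.
Proof. by move=> rho; rewrite /Lp_class reprK. Qed.

Lemma Lp_classP (f g : LpFun) :
  Lp_class f = Lp_class g <->
  {ae (@lebesgue_measure R), forall t, t \in `[tau, 0] -> f t = g t}.
Proof.
have -> : (Lp_class f = Lp_class g) = (f - g \in null_fun).
  by rewrite Quotient.idealrBE; apply/propext; split=> /eqP.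
have F : Filter (nbhs (almost_everywhere (@lebesgue_measure R))).
  exact: ae_filter_ringOfSetsType.
rewrite inE; split; apply: filterS => t fg /fg.
  by rewrite -[LHS]/(f t - g t) => /eqP; rewrite subr_eq0 => /eqP.
by move=> fgt; rewrite -[LHS]/(f t - g t) fgt subrr.
Qed.

Lemma Lp_classD (f g : LpFun) : Lp_class (f + g) = Lp_class f + Lp_class g.
Proof. exact: Quotient.pi_add. Qed.

Definition Lp_scale (a : R[i]) (rho : Lp) : Lp := Lp_class (a *: Lp_rep rho).

Lemma Lp_classZ a f : Lp_scale a (Lp_class f) = Lp_class (a *: f).
Proof.
apply/eqP; rewrite -Quotient.idealrBE -scalerBr rpredZ//.
by rewrite Quotient.idealrBE reprK.
Qed.

Lemma Lp_scaleA a b rho : Lp_scale a (Lp_scale b rho) = Lp_scale (a * b) rho.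
Proof. by rewrite -[rho]Lp_repK !Lp_classZ scalerA. Qed.

Lemma Lp_scale1 : left_id 1 Lp_scale.
Proof. by move=> rho; rewrite -[rho]Lp_repK Lp_classZ scale1r. Qed.

Lemma Lp_scaleDr : right_distributive Lp_scale +%R.
Proof.
move=> a rho1 rho2; rewrite -[rho1]Lp_repK -[rho2]Lp_repK.
by rewrite -Lp_classD !Lp_classZ scalerDr Lp_classD.
Qed.

Lemma Lp_scaleDl rho : {morph Lp_scale^~ rho : a b / a + b}.
Proof.
by move=> a b; rewrite -[rho]Lp_repK !Lp_classZ scalerDl Lp_classD.
Qed.

HB.instance Definition _ := GRing.Zmodule_isLmodule.Build R[i] Lp
  Lp_scaleA Lp_scale1 Lp_scaleDr Lp_scaleDl.

Definition Lp_norm (rho : Lp) : R := fine (pintegral rho) `^ p^-1.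

End Lp.

Section operators.
Context (R : realType) (V : lmodType R[i]).

(* A subspace of V carrying its own norm. *)
Record nspace := NSpace { ncar : set V; nnorm : V -> R }.

(* A possibly unbounded operator on V; only the values on dom matter. *)
Record operator := Operator { dom : set V; app :> V -> V }.

Definition linear_on (E : set V) (B : V -> V) : Prop :=
  forall (a : R[i]) x y, E x -> E y -> B (a *: x + y) = a *: B x + B y.

Definition linear_operator (B : operator) : Prop :=
  [/\ dom B 0, forall a x y, dom B x -> dom B y -> dom B (a *: x + y) &
      linear_on (dom B) B].

(* B is in L(Y, Z), with norm at most M *)
Definition opnorm_le (Y Z : nspace) (B : V -> V) (M : R) : Prop :=
  linear_on (ncar Y) B /\
  forall x, ncar Y x -> ncar Z (B x) /\ nnorm Z (B x) <= M * nnorm Y x.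

Definition bounded_op (Y : nspace) (B : V -> V) : Prop :=
  exists M, opnorm_le Y Y B M.

Definition op_inv (B : operator) : V -> V :=
  fun y => xget 0 [set x | dom B x /\ B x = y].

(* B : dom B -> Y is bijective with inverse in L(Y) *)
Definition has_bounded_inverse (Y : nspace) (B : operator) : Prop :=
  (forall y, ncar Y y -> exists! x, dom B x /\ B x = y) /\
  bounded_op Y (op_inv B).

(* I - h B *)
Definition I_sub (h : R) (B : operator) : operator :=
  Operator (dom B) (fun x => x - h%:C *: B x).

Definition everywhere (B : V -> V) : operator := Operator setT B.

(* ordprod F k m = F (m-1) o ... o F k; the identity if m <= k *)
Definition ordprod (F : nat -> V -> V) (k m : nat) : V -> V :=
  foldl (fun G i => F i \o G) id (index_iota k m).

(* K(t, x) = inf {|a|_Z0 + t |b|_Z1 : x = a + b}, which is +oo off Z0 + Z1 *)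
Definition K_functional (Z0 Z1 : nspace) (t : R) (x : V) : \bar R :=
  ereal_inf [set (nnorm Z0 ab.1 + t * nnorm Z1 ab.2)%:E
    | ab in [set ab : V * V |
        [/\ ncar Z0 ab.1, ncar Z1 ab.2 & ab.1 + ab.2 = x]]].

Definition interp1_norm (theta : R) (Z0 Z1 : nspace) (x : V) : \bar R :=
  (\int[lebesgue_measure]_(t in `]0%R, +oo[)
     ((t `^ (- theta - 1))%:E * K_functional Z0 Z1 t x))%E.

(* (Z0, Z1)_{theta, 1} *)
Definition real_interp1 (theta : R) (Z0 Z1 : nspace) : nspace :=
  NSpace [set x | (interp1_norm theta Z0 Z1 x < +oo)%E]
         (fun x => fine (interp1_norm theta Z0 Z1 x)).

End operators.

Section sectorial.
Context (R : realType) (X : normedModType R[i]).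

Definition whole : nspace X := NSpace setT rnorm.

Definition polar (r phi : R) : R[i] := (r * cos phi) +i* (r * sin phi).

Definition lam_sub (lam : R[i]) (A : operator X) : operator X :=
  Operator (dom A) (fun x => lam *: x - A x).

(* Densely defined closed sectorial operators of angle delta; these are
   exactly the generators of bounded analytic (strongly continuous)
   semigroups on a Banach space. *)
Definition sectorial (A : operator X) : Prop :=
  [/\ linear_operator A, dense (dom A),
      closed [set z : X * X | dom A z.1 /\ A z.1 = z.2] &
      exists delta : R, [/\ 0 < delta, delta <= pi / 2,
        forall r phi, 0 < r -> `|phi| < pi / 2 + delta ->
          has_bounded_inverse whole (lam_sub (polar r phi) A) &
        forall eps, 0 < eps -> eps < delta -> exists2 M, 1 <= M &
          forall r phi, 0 < r -> `|phi| <= pi / 2 + delta - eps ->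
            opnorm_le whole whole (op_inv (lam_sub (polar r phi) A)) (M / r)]].

End sectorial.

Section transport.
Context (R : realType) (X : normedModType R[i]) (tau p : R) (p1 : 1 < p).

Definition test_function (phi : R -> R) : Prop :=
  (forall n t, derivable (derive1n n phi) t 1) /\
  exists a b, [/\ tau < a, b < 0 & forall t, t \notin `[a, b] -> phi t = 0].

Definition weak_derivative (rho g : Lp X tau p1) : Prop :=
  forall phi, test_function phi ->
    bochner_integral `[tau, 0] (fun t => (derive1 phi t)%:C *: rho t) =
    - bochner_integral `[tau, 0] (fun t => (phi t)%:C *: g t).

Definition W1p : set (Lp X tau p1) :=
  [set rho | exists g, weak_derivative rho g].

Definition partial_sigma (rho : Lp X tau p1) : Lp X tau p1 :=
  xget 0 [set g | weak_derivative rho g].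

(* rho(0) = u, for the representative of rho continuous on [tau, 0] *)
Definition trace0 (rho : Lp X tau p1) (u : X) : Prop :=
  exists r : R -> X, [/\ {within `[tau, 0], continuous r},
    {ae (@lebesgue_measure R), forall t, t \in `[tau, 0] -> rho t = r t} &
    r 0 = u].

Definition Ep : lmodType R[i] := (X * Lp X tau p1)%type.

Definition Ep_space : nspace Ep :=
  NSpace setT (fun x : Ep => rnorm x.1 + Lp_norm x.2).

Definition C_op : operator Ep :=
  Operator [set x : Ep | W1p x.2 /\ trace0 x.2 x.1]
           (fun x : Ep => (0, partial_sigma x.2) : Ep).

Definition DC : nspace Ep :=
  NSpace (dom C_op)
         (fun x => nnorm Ep_space x + nnorm Ep_space (C_op x)).

Definition DC2 : nspace Ep :=
  NSpace [set x | dom C_op x /\ dom C_op (C_op x)]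
         (fun x => nnorm Ep_space x + nnorm Ep_space (C_op x)
                   + nnorm Ep_space (C_op (C_op x))).

Definition Y_space (theta : R) : nspace Ep := real_interp1 theta DC DC2.

Variables (A : operator X) (D : R -> Ep -> Ep).

Definition A0 : operator Ep :=
  Operator [set x : Ep | dom A x.1] (fun x : Ep => (A x.1, 0) : Ep).

(* D t is only meaningful on dom C_op *)
Definition full_op (t : R) : operator Ep :=
  Operator (dom A0 `&` dom C_op) (fun x => A0 x + C_op x + D t x).

Definition S_AC (h : R) : Ep -> Ep :=
  op_inv (I_sub h C_op) \o op_inv (I_sub h A0).

Definition H_op (h t : R) : Ep -> Ep := fun x => h%:C *: D t (S_AC h x).

Definition I_sub_H (h t : R) : operator Ep :=
  everywhere (fun x => x - H_op h t x).

Definition P_op (h t : R) : Ep -> Ep := op_inv (I_sub_H h t) \o S_AC h.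

Definition P_well_defined (h t : R) : Prop :=
  [/\ has_bounded_inverse Ep_space (I_sub h C_op),
      has_bounded_inverse Ep_space (I_sub h A0) &
      has_bounded_inverse Ep_space (I_sub_H h t)].

Definition R_op (h t : R) : Ep -> Ep := op_inv (I_sub h (full_op t)).

Definition R_well_defined (h t : R) : Prop :=
  has_bounded_inverse Ep_space (I_sub h (full_op t)).

End transport.

(* Main.v *)
(* The difference of the two products telescopes:
     F_{n-1:0} - G_{n-1:0} = sum_(k < n) F_{n-1:k+1} (F_k - G_k) G_{k-1:0}.
   Each term is bounded from Y to E by M_F (K h^(1+theta)) M_G, and there are
   n <= S / h of them, so one power of h is lost.  Summing in E needs the
   triangle inequality for the norm of L^p, hence Minkowski's inequality for
   the functions |f(.)| restricted to [tau, 0]. *)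
Require Import Defs.
From mathcomp Require Import all_boot all_order all_algebra.
From mathcomp Require Import complex.
From mathcomp Require Import all_classical all_reals all_analysis.
From mathcomp Require Import measurable_realfun ring.
Import Order.TTheory GRing.Theory Num.Theory.
Import numFieldNormedType.Exports.
Local Open Scope classical_set_scope.
Local Open Scope complex_scope.
Local Open Scope ring_scope.

(** * Ordered products of operators and their telescoping difference *)

Lemma opnorm_le_weaken (R : realType) (V : lmodType R[i]) (Y Z : nspace V)
    (B : V -> V) (M M' : R) :
  (forall x, 0 <= nnorm Y x) -> M <= M' ->
  opnorm_le Y Z B M -> opnorm_le Y Z B M'.
Proof.
move=> Y0 MM' [Blin Bb]; split=> // x /Bb[Zx le]; split=> //.
by apply: le_trans le _; apply: ler_wpM2r.
Qed.

Lemma linear_onB (R : realType) (V : lmodType R[i]) (E : set V) (B C : V -> V) :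
  linear_on E B -> linear_on E C -> linear_on E (fun x => B x - C x).
Proof.
move=> Bl Cl a x y Ex Ey; rewrite Bl// Cl// opprD addrACA scalerBr.
by rewrite -scalerN.
Qed.

Lemma ordprod_id (R : realType) (V : lmodType R[i]) (F : nat -> V -> V) k m :
  (m <= k)%N -> ordprod F k m = id.
Proof. by move=> mk; rewrite /ordprod /index_iota (eqP mk). Qed.

Lemma ordprod_recr (R : realType) (V : lmodType R[i]) (F : nat -> V -> V) k m :
  (k <= m)%N -> ordprod F k m.+1 = F m \o ordprod F k m.
Proof.
by move=> km; rewrite /ordprod /index_iota subSn// -addn1 iotaD foldl_cat subnKC.
Qed.

(** The fold grows at the factor applied last, so the factor applied first is reached by induction
    on the upper index. *)
Lemma ordprod_recl (R : realType) (V : lmodType R[i]) (F : nat -> V -> V) k m :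
  (k < m)%N -> ordprod F k m = ordprod F k.+1 m \o F k.
Proof.
elim: m => // m IH; rewrite ltnS leq_eqVlt => /predU1P[->|km].
  by rewrite ordprod_recr// !ordprod_id.
by rewrite !ordprod_recr ?(ltnW km)// IH.
Qed.

Lemma ordprod_const (R : realType) (V : lmodType R[i]) (B : V -> V) k m :
  ordprod (fun=> B) k m = iter (m - k) B.
Proof.
have [mk|km] := leqP m k; first by rewrite ordprod_id// (eqP mk).
rewrite -{1}(subnKC (ltnW km)); elim: (m - k)%N => [|n IH].
  by rewrite addn0 ordprod_id.
by rewrite addnS ordprod_recr ?leq_addr// IH.
Qed.

(** An [nspace] carries no norm axioms, so the facts that the sum needs in [E] enter as hypotheses.
    The bound on the tails of [F] includes [k = n], because the last summand has the identity on its
    left. *)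
Lemma opnorm_le_ordprodB (R : realType) (V : lmodType R[i]) (Y E : nspace V)
    (F G : nat -> V -> V) (n : nat) (MF MG e : R) :
  ncar E = setT -> nnorm E 0 = 0 ->
  (forall x y, nnorm E (x + y) <= nnorm E x + nnorm E y) ->
  0 <= MF -> 0 <= e ->
  (forall k, (k <= n)%N -> opnorm_le E E (ordprod F k n) MF) ->
  (forall k, (k <= n)%N -> opnorm_le Y Y (ordprod G 0 k) MG) ->
  (forall k, (k < n)%N -> opnorm_le Y E (fun x => F k x - G k x) e) ->
  opnorm_le Y E (fun x => ordprod F 0 n x - ordprod G 0 n x)
    (n%:R * (MF * e * MG)).
Proof.
move=> ET E0 ED MF0 e0 hF hG hFG; split.
  apply: linear_onB; last by have [] := hG n (leqnn n).
  have [Fl _] := hF 0%N isT.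
  by move=> a x y _ _; apply: Fl; rewrite ET.
move=> x Yx; split; first by rewrite ET.
(* Mixed products: [Z 0] is the product of the [F k] at [x], [Z n] that of the [G k], and each unit
   step costs one summand. *)
pose Z k := ordprod F k n (ordprod G 0 k x).
suff: forall m, (m <= n)%N ->
    nnorm E (Z 0%N - Z m) <= m%:R * (MF * e * MG) * nnorm Y x.
  by move=> /(_ n (leqnn n)); rewrite /Z (ordprod_id _ _ G 0 0)// (ordprod_id _ _ F n n).
elim=> [_|m IH mn]; first by rewrite subrr E0 mul0r mul0r.
rewrite -(subrKA (Z m)); apply: le_trans (ED _ _) _.
rewrite -natr1 mulrDl mul1r mulrDl; apply: lerD; first exact/IH/ltnW.
have [_ /(_ _ Yx)[Yy yle]] := hG m (ltnW mn).
have [_ /(_ _ Yy)[_ dle]] := hFG m mn.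
have [Fl Fb] := hF m.+1 mn.
have -> : Z m - Z m.+1 =
    ordprod F m.+1 n (F m (ordprod G 0 m x) - G m (ordprod G 0 m x)).
  (* [linear_on] speaks of [a *: x + y]; a difference is the case [a = -1]. *)
  have /= := Fl (-1) (G m (ordprod G 0 m x)) (F m (ordprod G 0 m x)).
  rewrite ET !scaleN1r addrC => ->//.
  by rewrite /Z (ordprod_recl _ _ F m)// ordprod_recr// addrC.
have [|_ le] := Fb (F m (ordprod G 0 m x) - G m (ordprod G 0 m x)).
  by rewrite ET.
(* The factors are bounded from the outside in: [MF] on [E], [e] from [Y] to [E], [MG] on [Y]. *)
apply: le_trans le _; rewrite -!mulrA ler_wpM2l//.
by apply: le_trans dle _; rewrite ler_wpM2l.
Qed.

(** * The triangle inequality in L^p([tau, 0]; X) *)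

Lemma Lnorm_LpFun (R : realType) (X : normedModType R[i]) (tau p : R)
    (hp : 1 < p) (f : LpFun X tau p) :
  Lnorm lebesgue_measure p%:E (EFin \o ((rnorm \o f) \_ `[tau, 0])) =
  (fine (pintegral tau p f) `^ p^-1)%:E.
Proof.
have p0 : p != 0 by rewrite gt_eqF// (lt_trans ltr01).
have [_ fin] : LpFun_set tau p f by have := valP f; rewrite inE.
rewrite unlock -poweR_EFin fineK; last first.
  rewrite ge0_fin_numE//; apply: integral_ge0 => t _.
  by rewrite lee_fin powR_ge0.
rewrite /pintegral [in RHS]integral_mkcond; congr (poweR _ _).
apply: eq_integral => t _; rewrite /= !patchE; case: ifP => _.
  by rewrite ger0_norm ?rnorm_ge0.
by rewrite -[LHS]/((`|0 : R| `^ p)%:E) normr0 powR0.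
Qed.

(** [Lp_norm] is computed on a chosen representative; any other one agrees with it almost everywhere
    on [[tau, 0]] and so has the same integral. *)
Lemma Lp_normE (R : realType) (X : normedModType R[i]) (tau p : R)
    (hp : 1 < p) (f : LpFun X tau p) :
  Lp_norm (Lp_class hp f) = fine (pintegral tau p f) `^ p^-1.
Proof.
rewrite /Lp_norm; suff -> : pintegral tau p (Lp_rep (Lp_class hp f)) =
    pintegral tau p f by [].
have mLp (g : LpFun X tau p) : strongly_measurable g.
  by have := valP g; rewrite inE => -[].
apply: ge0_ae_eq_integral => //; try by move=> t _; rewrite lee_fin powR_ge0.
- by apply: measurable_rnorm_powR; exact: mLp.
- by apply: measurable_rnorm_powR; exact: mLp.
have /Lp_classP := Lp_repK (Lp_class hp f).
have F : Filter (nbhs (almost_everywhere (@lebesgue_measure R))).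
  exact: ae_filter_ringOfSetsType.
by apply: filterS => t fg /= tI; rewrite /Lp_fun fg.
Qed.

Lemma Lp_norm0 (R : realType) (X : normedModType R[i]) (tau p : R)
    (hp : 1 < p) :
  Lp_norm (0 : Lp X tau hp) = 0.
Proof.
have p0 : p != 0 by rewrite gt_eqF// (lt_trans ltr01).
(* 0 of LpFun cannot be written directly: its module structure depends on hp,
   which its type does not mention. *)
rewrite -(scale0r (0 : Lp X tau hp)) -[_ *: _]/(Lp_scale 0 0) /Lp_scale Lp_normE.
set f := _ *: _.
have f0 t : LpFun_val f t = 0 by exact: scale0r.
have -> : pintegral tau p f = 0%E.
  rewrite /pintegral integral0_eq// => t _.
  by rewrite f0 rnorm0 powR0.
by rewrite /= powR0// invr_neq0.
Qed.

Lemma ler_Lp_normD (R : realType) (X : normedModType R[i]) (tau p : R)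
    (hp : 1 < p) (rho1 rho2 : Lp X tau hp) :
  Lp_norm (rho1 + rho2) <= Lp_norm rho1 + Lp_norm rho2.
Proof.
rewrite -[rho1]Lp_repK -[rho2]Lp_repK -Lp_classD.
move: (Lp_rep rho1) (Lp_rep rho2) => f g.
(* The sum is generalised to any [k] with these pointwise values, which frees the rest from the
   module structure of [LpFun]. *)
set k := f + g; have kE t : k t = f t + g t by [].
move: k kE => k kE.
have mLp (u : LpFun X tau p) :
    measurable_fun setT ((rnorm \o u) \_ `[tau, 0]).
  apply/(measurable_restrictT _ _).1; first exact: measurable_itv.
  by apply: measurable_rnorm; have := valP u; rewrite inE => -[].
have := minkowski_EFin lebesgue_measure (mLp f) (mLp g) (ltW hp).
rewrite !Lnorm_LpFun// -EFinD.
rewrite !Lp_normE -lee_fin.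
(* Minkowski bounds the norm of |f| + |g|; it remains to compare |k| with |f| + |g|. *)
apply: le_trans.
rewrite -Lnorm_LpFun//.
rewrite unlock/=.
have p0 : 0 < p := lt_trans ltr01 hp.
have mpow (u : R -> R) : measurable_fun setT u ->
    measurable_fun setT (fun t => (`|u t| `^ p)%:E).
  move=> mu; apply/measurable_EFinP.
  apply: (measurableT_comp (measurable_powR p)).
  exact: measurableT_comp.
(* The root is monotone, so it suffices to compare integrands: by the triangle inequality of X on
   [[tau, 0]], both being 0 elsewhere. *)
apply: gt0_ler_poweR; rewrite ?invr_ge0 ?(ltW p0)// ?in_itv/= ?leey ?andbT;
  try by apply: integral_ge0 => t _; rewrite lee_fin powR_ge0.
apply: ge0_le_integral => //.
- exact: (mpow _ (mLp k)).
- exact: (mpow _ (measurable_funD (mLp f) (mLp g))).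
move=> t _; rewrite lee_fin ge0_ler_powR ?nnegrE ?(ltW p0)//.
rewrite !patchE; case: ifP => _; last by rewrite -[X in X + X]/(0 : R) addr0.
by rewrite /= kE !ger0_norm ?addr_ge0 ?rnorm_ge0// ler_rnormD.
Qed.

(** * Norm properties of the interpolation space and of E_p *)

Lemma K_functional_ge0 (R : realType) (V : lmodType R[i]) (Z0 Z1 : nspace V)
    (t : R) (x : V) :
  (forall y, 0 <= nnorm Z0 y) -> (forall y, 0 <= nnorm Z1 y) -> 0 <= t ->
  (0 <= K_functional Z0 Z1 t x)%E.
Proof.
move=> N0 N1 t0; apply: le_ereal_inf_tmp => _ [ab _ <-].
by rewrite lee_fin addr_ge0// mulr_ge0.
Qed.

(** This lets operator bounds on the interpolation space be enlarged. It holds off that space too,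
    where [fine] sends +oo to 0. *)
Lemma real_interp1_norm_ge0 (R : realType) (V : lmodType R[i]) (theta : R)
    (Z0 Z1 : nspace V) (x : V) :
  (forall y, 0 <= nnorm Z0 y) -> (forall y, 0 <= nnorm Z1 y) ->
  0 <= nnorm (real_interp1 theta Z0 Z1) x.
Proof.
move=> N0 N1; apply: fine_ge0; apply: integral_ge0 => t /=.
rewrite in_itv/= andbT => t0; apply: mule_ge0; first by rewrite lee_fin powR_ge0.
exact/K_functional_ge0/ltW.
Qed.

Lemma Ep_norm_ge0 (R : realType) (X : normedModType R[i]) (tau p : R)
    (hp : 1 < p) (x : Ep X tau hp) :
  0 <= nnorm (Ep_space X tau hp) x.
Proof. by rewrite /= addr_ge0 ?rnorm_ge0// powR_ge0. Qed.

Lemma Ep_norm0 (R : realType) (X : normedModType R[i]) (tau p : R)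
    (hp : 1 < p) :
  nnorm (Ep_space X tau hp) 0 = 0.
Proof. by rewrite /= rnorm0 Lp_norm0 addr0. Qed.

Lemma ler_Ep_normD (R : realType) (X : normedModType R[i]) (tau p : R)
    (hp : 1 < p) (x y : Ep X tau hp) :
  nnorm (Ep_space X tau hp) (x + y) <=
  nnorm (Ep_space X tau hp) x + nnorm (Ep_space X tau hp) y.
Proof. by rewrite /= addrACA lerD ?ler_rnormD ?ler_Lp_normD. Qed.

Lemma Y_norm_ge0 (R : realType) (X : normedModType R[i]) (tau p : R)
    (hp : 1 < p) (theta : R) (x : Ep X tau hp) :
  0 <= nnorm (Y_space X tau hp theta) x.
Proof.
have N := @Ep_norm_ge0 R X tau p hp.
apply: real_interp1_norm_ge0 => y; first exact: addr_ge0.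
by apply: addr_ge0; first exact: addr_ge0.
Qed.

(** * From stability and consistency to the global error *)

Lemma opnorm_le_id (R : realType) (V : lmodType R[i]) (Y : nspace V) :
  opnorm_le Y Y id 1.
Proof. by split=> [a x y _ _//|x Yx]; rewrite mul1r. Qed.

Lemma opnorm_le_global_error (R : realType) (X : normedModType R[i])
    (tau p : R) (hp : 1 < p) (F G : nat -> Ep X tau hp -> Ep X tau hp)
    (n : nat) (h theta K MF MG S : R) :
  0 < h -> n%:R * h <= S -> 0 <= K -> 0 <= MF -> 0 <= MG ->
  (forall k, (k <= n)%N ->
    opnorm_le (Ep_space X tau hp) (Ep_space X tau hp) (ordprod F k n) MF) ->
  (forall k, (k <= n)%N -> opnorm_le (Y_space X tau hp theta)
    (Y_space X tau hp theta) (ordprod G 0 k) MG) ->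
  (forall k, (k < n)%N -> opnorm_le (Y_space X tau hp theta)
    (Ep_space X tau hp) (fun x => F k x - G k x) (K * h `^ (1 + theta))) ->
  opnorm_le (Y_space X tau hp theta) (Ep_space X tau hp)
    (fun x => ordprod F 0 n x - ordprod G 0 n x)
    (S * MF * K * MG * h `^ theta).
Proof.
move=> h0 nhS K0 MF0 MG0 hF hG hFG.
apply: (opnorm_le_weaken _ _ _ _ _
  (n%:R * (MF * (K * h `^ (1 + theta)) * MG))); first exact: Y_norm_ge0.
  have -> : h `^ (1 + theta) = h * h `^ theta.
    by rewrite powRD ?powRr1 ?(ltW h0)// (gt_eqF h0) implybT.
  (* Isolating the factor [n%:R * h] allows it to be replaced by [S]. *)
  have -> : n%:R * (MF * (K * (h * h `^ theta)) * MG) =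
      (n%:R * h) * (MF * K * MG * h `^ theta) by ring.
  have -> : S * MF * K * MG * h `^ theta =
      S * (MF * K * MG * h `^ theta) by ring.
  by rewrite ler_wpM2r// !mulr_ge0 ?powR_ge0.
apply: opnorm_le_ordprodB => //.
- exact: Ep_norm0.
- exact: ler_Ep_normD.
- by rewrite mulr_ge0 ?powR_ge0.
Qed.

Theorem theorem7p10 (R : realType) (X : completeNormedModType R[i])
  (tau p : R) (htau : tau < 0) (hp : 1 < p)
  (A : operator X) (hA : sectorial A)
  (D : R -> Ep X tau hp -> Ep X tau hp)
  (T h0 q theta K : R)
  (hT : 0 < T) (hh0 : 0 < h0) (hq : 0 < q < 1) (htheta : 0 < theta < 1)
  (hK : 0 < K)
  (hD : forall t, 0 <= t <= T -> linear_on (dom (C_op X tau hp)) (D t))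
  (hsmall : forall t h, 0 <= t <= T -> 0 < h <= h0 ->
    opnorm_le (Ep_space X tau hp) (Ep_space X tau hp) (H_op A D h t) q)
  (hR : forall t h, 0 <= t <= T -> 0 < h <= h0 -> R_well_defined A D h t)
  (hP : forall t h, 0 <= t <= T -> 0 < h <= h0 -> P_well_defined A D h t)
  (hRP : forall t h, 0 <= t <= T -> 0 < h <= h0 ->
    opnorm_le (Y_space X tau hp theta) (Ep_space X tau hp)
      (fun x => R_op A D h t x - P_op A D h t x) (K * h `^ (1 + theta))) :
  ((forall t x, 0 <= t <= T -> dom (C_op X tau hp) x -> D t x = D 0 x) ->
   (forall T' : R, 0 < T' -> exists MR MP : R,
      forall (h : R) (n : nat), 0 < h <= h0 -> n%:R * h <= T' ->
        opnorm_le (Ep_space X tau hp) (Ep_space X tau hp)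
          (iter n (R_op A D h 0)) MR /\
        opnorm_le (Y_space X tau hp theta) (Y_space X tau hp theta)
          (iter n (P_op A D h 0)) MP) ->
   forall T' : R, 0 < T' -> exists2 KT : R, 0 < KT &
     forall (h : R) (n : nat), 0 < h <= h0 -> n%:R * h <= T' ->
       opnorm_le (Y_space X tau hp theta) (Ep_space X tau hp)
         (fun x => iter n (R_op A D h 0) x - iter n (P_op A D h 0) x)
         (KT * h `^ theta))
  /\
  ((exists MR : R, forall (h : R) (j k : nat), 0 < h <= h0 ->
      (k <= j)%N -> j%:R * h <= T ->
      opnorm_le (Ep_space X tau hp) (Ep_space X tau hp)
        (ordprod (fun i => R_op A D h (i%:R * h)) k j.+1) MR) ->
   (exists MP : R, forall (h : R) (k : nat), 0 < h <= h0 -> k%:R * h <= T ->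
      opnorm_le (Y_space X tau hp theta) (Y_space X tau hp theta)
        (ordprod (fun i => P_op A D h (i%:R * h)) 0 k) MP) ->
   exists2 KT : R, 0 < KT &
     forall (h : R) (n : nat), 0 < h <= h0 -> n%:R * h <= T ->
       opnorm_le (Y_space X tau hp theta) (Ep_space X tau hp)
         (fun x => ordprod (fun i => R_op A D h (i%:R * h)) 0 n x
                 - ordprod (fun i => P_op A D h (i%:R * h)) 0 n x)
         (KT * h `^ theta)).
Proof.
(* The stability constants come without a sign. Their maximum with 1 is positive, as the final
   constant must be, and also bounds the identity. *)
have max0 (M : R) : 0 <= Num.max M 1 by rewrite le_max ler01 orbT.
have maxgt0 (M : R) : 0 < Num.max M 1 by rewrite lt_max ltr01 orbT.
have maxl (M : R) : M <= Num.max M 1 by rewrite le_max lexx.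
have maxr (M : R) : 1 <= Num.max M 1 by rewrite le_max lexx orbT.
have NE := @Ep_norm_ge0 R X tau p hp.
have NY := @Y_norm_ge0 R X tau p hp theta.
have mono (h : R) (m n : nat) S : 0 < h -> (m <= n)%N ->
    n%:R * h <= S -> m%:R * h <= S.
  move=> h_gt0 mn; apply: le_trans.
  by rewrite ler_wpM2r ?(ltW h_gt0)// ler_nat.
split.
  move=> _ stab S S0; have [MR [MP stabS]] := stab S S0.
  exists (S * Num.max MR 1 * K * Num.max MP 1); first by rewrite !mulr_gt0.
  move=> h n hh nhS; have /andP[h_gt0 _] := hh.
  have iterE (B : Ep X tau hp -> Ep X tau hp) :
      iter n B = ordprod (fun=> B) 0 n by rewrite ordprod_const subn0.
  rewrite (iterE (R_op _ _ _ _)) (iterE (P_op _ _ _ _)).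
  apply: opnorm_le_global_error => //; first exact: ltW.
  - move=> k kn; rewrite ordprod_const; apply: opnorm_le_weaken (maxl MR) _ => //.
    by have [] := stabS h (n - k)%N hh (mono _ _ _ _ h_gt0 (leq_subr k n) nhS).
  - move=> k kn; rewrite ordprod_const subn0.
    apply: opnorm_le_weaken (maxl MP) _ => //.
    by have [] := stabS h k hh (mono _ _ _ _ h_gt0 kn nhS).
  (* Consistency is used at time 0 only, which lies in [[0, T]] even if the horizon [S] exceeds
     [T]. *)
  - by move=> k _; apply: hRP => //; rewrite lexx ltW.
move=> [MR stabR] [MP stabP].
exists (T * Num.max MR 1 * K * Num.max MP 1); first by rewrite !mulr_gt0.
move=> h n hh nhT; have /andP[h_gt0 _] := hh.
apply: opnorm_le_global_error => //; first exact: ltW.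
(* The stability hypothesis covers nonempty products only; the empty one, [k = n], is the identity,
   of norm at most 1. *)
- move=> k; rewrite leq_eqVlt => /predU1P[->|].
    rewrite ordprod_id//; apply: opnorm_le_weaken (maxr MR) _ => //.
    exact: opnorm_le_id.
  (* With [n.+1] factors in all, the last index is [j = n], and its time is at most [T] because that
     of [n.+1] is. *)
  case: n nhT => // n nhT kn; apply: opnorm_le_weaken (maxl MR) _ => //.
  exact: stabR (mono _ _ _ _ h_gt0 (leqnSn n) nhT).
- move=> k kn; apply: opnorm_le_weaken (maxl MP) _ => //.
  exact: stabP (mono _ _ _ _ h_gt0 kn nhT).
- move=> k kn; apply: hRP => //.
  by rewrite mulr_ge0 ?(ltW h_gt0)//= (mono _ _ _ _ h_gt0 (ltnW kn) nhT).
Qed.
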